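(* $$\pi\sqrt{3}=\frac{9}{8}\sum_{n=0}^{\infty}\frac{(-1)^n}{8^n}\left[\frac{4}{3n+1}+\frac{2}{3n+2}\right].$$ *)

(* Defs.v *)
From Stdlib Require Import Reals.
From Coquelicot Require Import Coquelicot.

(* Main.v *)
Require Import Defs.
From Stdlib Require Import Reals.
From Coquelicot Require Import Coquelicot.
From Stdlib Require Import Lra Lia.
Open Scope R_scope.

(** Since 8 + x^3 = (x + 2) (x^2 - 2 x + 4), the series is the expansion of a
    rational integral: integrating a geometric series of ratio - x^3 / 8 term
    by term,
      sum_n (-1/8)^n (4 / (3n+1) + 2 / (3n+2))
        = int_0^1 (4 + 2 x) / (1 + x^3 / 8) dx
        = int_0^1 16 / (x^2 - 2 x + 4) dx
        = 16 / sqrt 3 * atan (1 / sqrt 3) = 8 PI / (3 sqrt 3),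
    and 9/8 times this is PI sqrt 3.

    The exchange of sum and integral is justified by differentiation.  The
    partial sums [psum N x] of the integrated power series and the arctangent
    primitive [prim x] have derivatives that differ by
    (- x^3 / 8)^(N+1) * 16 / (x^2 - 2 x + 4), which on [0, 1] is at most
    (16 / 3) (1/8)^(N+1) in absolute value; the mean value theorem turns this into
    an error bound
    on the partial sums of the series ([psum_error]), hence convergence to
    [prim 1 - prim 0]. *)

Definition prim (x : R) : R := 16 / sqrt 3 * atan ((x - 1) / sqrt 3).

Definition term (n : nat) (x : R) : R :=
  (- (1 / 8)) ^ n *
  (4 * (x ^ (3 * n + 1) / INR (3 * n + 1)) +
   2 * (x ^ (3 * n + 2) / INR (3 * n + 2))).

Definition psum (N : nat) (x : R) : R := sum_n (fun n => term n x) N.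

Lemma quad_ge3 (x : R) : 3 <= x ^ 2 - 2 * x + 4.
Proof. pose proof (pow2_ge_0 (x - 1)); lra. Qed.

Lemma is_derive_prim (x : R) : is_derive prim x (16 / (x ^ 2 - 2 * x + 4)).
Proof.
  assert (Hs : 0 < sqrt 3) by (apply sqrt_lt_R0; lra).
  assert (Hss : sqrt 3 ^ 2 = 3) by (apply pow2_sqrt; lra).
  pose proof (quad_ge3 x) as Hq.
  unfold prim; auto_derive; [exact I |].
  assert (Hd : 1 + ((x - 1) / sqrt 3) ^ 2 = (x ^ 2 - 2 * x + 4) / sqrt 3 ^ 2).
  { transitivity ((sqrt 3 ^ 2 + (x - 1) ^ 2) / sqrt 3 ^ 2).
    - field; lra.
    - rewrite Hss; field. }
  unfold Rsqr.
  replace (1 + (x + - (1)) * / sqrt 3 * ((x + - (1)) * / sqrt 3 * 1))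
    with ((x ^ 2 - 2 * x + 4) / sqrt 3 ^ 2)
    by (rewrite <- Hd; field; lra).
  field; split; lra.
Qed.

Lemma is_derive_pow_div (k : nat) (x : R) :
  is_derive (fun t => t ^ (k + 1) / INR (k + 1)) x (x ^ k).
Proof.
  assert (Hk : INR (k + 1) <> 0) by (apply not_0_INR; lia).
  auto_derive; [exact I |].
  replace (pred (k + 1)) with k by lia.
  field; exact Hk.
Qed.

(** Written with the factor 1 - q, q = - x^3 / 8, so that the sum over [n]
    telescopes. *)
Lemma is_derive_term (n : nat) (x : R) :
  is_derive (term n) x
    (16 / (x ^ 2 - 2 * x + 4) * (1 - - (x ^ 3 / 8)) * (- (x ^ 3 / 8)) ^ n).
Proof.
  pose proof (quad_ge3 x) as Hq.
  replace (16 / (x ^ 2 - 2 * x + 4) * (1 - - (x ^ 3 / 8)) * (- (x ^ 3 / 8)) ^ n)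
    with ((- (1 / 8)) ^ n * (4 * x ^ (3 * n) + 2 * x ^ (3 * n + 1))).
  - unfold term.
    apply is_derive_scal.
    apply (is_derive_plus (V := R_NormedModule)); apply is_derive_scal.
    + apply is_derive_pow_div.
    + replace (3 * n + 2)%nat with (3 * n + 1 + 1)%nat by lia.
      apply is_derive_pow_div.
  - replace (- (x ^ 3 / 8)) with (- (1 / 8) * x ^ 3) by field.
    rewrite Rpow_mult_distr, <- pow_mult, pow_add.
    field; lra.
Qed.

Lemma is_derive_psum (N : nat) (x : R) :
  is_derive (psum N) x
    (16 / (x ^ 2 - 2 * x + 4) * (1 - (- (x ^ 3 / 8)) ^ S N)).
Proof.
  induction N as [|N IH].
  - apply (is_derive_ext (term 0)).
    + intros t; unfold psum; now rewrite sum_O.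
    + replace (16 / (x ^ 2 - 2 * x + 4) * (1 - (- (x ^ 3 / 8)) ^ 1))
        with (16 / (x ^ 2 - 2 * x + 4) * (1 - - (x ^ 3 / 8))
              * (- (x ^ 3 / 8)) ^ 0) by (simpl; ring).
      apply is_derive_term.
  - apply (is_derive_ext (fun t => psum N t + term (S N) t)).
    + intros t; unfold psum; now rewrite sum_Sn.
    + replace (16 / (x ^ 2 - 2 * x + 4) * (1 - (- (x ^ 3 / 8)) ^ S (S N)))
        with (16 / (x ^ 2 - 2 * x + 4) * (1 - (- (x ^ 3 / 8)) ^ S N)
              + 16 / (x ^ 2 - 2 * x + 4) * (1 - - (x ^ 3 / 8))
                * (- (x ^ 3 / 8)) ^ S N)
        by (rewrite <- (tech_pow_Rmult _ (S N)); ring).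
      apply (is_derive_plus (V := R_NormedModule)); [exact IH |].
      apply is_derive_term.
Qed.

Lemma term_0 (n : nat) : term n 0 = 0.
Proof. unfold term; rewrite !pow_i by lia; unfold Rdiv; ring. Qed.

Lemma psum_0 (N : nat) : psum N 0 = 0.
Proof.
  unfold psum.
  rewrite (sum_n_ext _ (fun _ => 0) _ term_0), sum_n_const; ring.
Qed.

Lemma term_1 (n : nat) :
  term n 1 = (-1) ^ n / 8 ^ n * (4 / (3 * INR n + 1) + 2 / (3 * INR n + 2)).
Proof.
  unfold term.
  replace (- (1 / 8)) with (-1 * / 8) by field.
  rewrite Rpow_mult_distr, pow_inv, !pow1, !plus_INR, mult_INR.
  change (INR 1) with 1.
  replace (INR 3) with 3 by (simpl; ring).
  replace (INR 2) with 2 by (simpl; ring).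
  unfold Rdiv; ring.
Qed.

(** The derivative of [prim - psum N] is the tail of the geometric series; on
    [0, 1] the ratio is at most 1/8 in absolute value and the quadratic factor is
    at least 3, so the mean value theorem gives the bound. *)
Lemma psum_error (N : nat) :
  Rabs (psum N 1 - (prim 1 - prim 0)) <= 16 / 3 * (1 / 8) ^ S N.
Proof.
  set (dh := fun x => 16 / (x ^ 2 - 2 * x + 4) * (- (x ^ 3 / 8)) ^ S N).
  assert (Hd : forall x, is_derive (fun t => prim t - psum N t) x (dh x)).
  { intros x; unfold dh.
    replace (16 / (x ^ 2 - 2 * x + 4) * (- (x ^ 3 / 8)) ^ S N)
      with (16 / (x ^ 2 - 2 * x + 4)
            - 16 / (x ^ 2 - 2 * x + 4) * (1 - (- (x ^ 3 / 8)) ^ S N)) by ring.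
    apply (is_derive_minus (V := R_NormedModule));
      [apply is_derive_prim | apply is_derive_psum]. }
  destruct (MVT_gen (fun t => prim t - psum N t) 0 1 dh) as [c [Hc Heq]].
  - intros x _; apply Hd.
  - intros x _; apply derivable_continuous_pt.
    exists (dh x); apply is_derive_Reals, Hd.
  - rewrite Rmin_left, Rmax_right in Hc by lra.
    rewrite psum_0 in Heq.
    replace (psum N 1 - (prim 1 - prim 0)) with (- dh c) by lra.
    rewrite Rabs_Ropp; unfold dh.
    pose proof (quad_ge3 c) as Hq.
    assert (Hc3 : 0 <= c ^ 3 <= 1).
    { split; [apply pow_le; lra |].
      rewrite <- (pow1 3); apply pow_incr; lra. }
    rewrite Rabs_mult, <- RPow_abs, Rabs_Ropp.
    apply Rmult_le_compat.
    + apply Rabs_pos.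
    + apply pow_le, Rabs_pos.
    + rewrite Rabs_pos_eq.
      * apply Rmult_le_compat_l; [lra |].
        apply Rinv_le_contravar; lra.
      * apply Rlt_le, Rdiv_lt_0_compat; lra.
    + apply pow_incr; split; [apply Rabs_pos |].
      rewrite Rabs_pos_eq; lra.
Qed.

Lemma is_series_term_1 : is_series (fun n => term n 1) (prim 1 - prim 0).
Proof.
  change (is_lim_seq (fun N => psum N 1) (prim 1 - prim 0)).
  apply (is_lim_seq_ext
           (fun N => (prim 1 - prim 0) + (psum N 1 - (prim 1 - prim 0)))).
  { intros N; ring. }
  replace (Finite (prim 1 - prim 0)) with (Finite ((prim 1 - prim 0) + 0))
    by (f_equal; ring).
  apply is_lim_seq_plus'; [apply is_lim_seq_const |].
  apply is_lim_seq_abs_0.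
  apply (is_lim_seq_le_le (fun _ => 0) _ (fun N => 16 / 3 * (1 / 8) ^ S N)).
  - intros N; split; [apply Rabs_pos | apply psum_error].
  - apply is_lim_seq_const.
  - replace (Finite 0) with (Rbar_mult (16 / 3) 0)
      by (simpl; f_equal; ring).
    apply is_lim_seq_scal_l.
    apply -> (is_lim_seq_incr_1 (fun N => (1 / 8) ^ N)).
    apply is_lim_seq_geom; rewrite Rabs_pos_eq; lra.
Qed.

Lemma prim_diff : prim 1 - prim 0 = 16 / sqrt 3 * (PI / 6).
Proof.
  assert (Hs : 0 < sqrt 3) by (apply sqrt_lt_R0; lra).
  unfold prim.
  replace ((1 - 1) / sqrt 3) with 0 by (field; lra).
  replace ((0 - 1) / sqrt 3) with (- (1 / sqrt 3)) by (field; lra).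
  rewrite atan_0, atan_opp, <- tan_PI6, atan_tan.
  - ring.
  - pose proof PI_RGT_0; lra.
Qed.

(* [Series] is total, so convergence is asserted separately. *)
Theorem mainTheorem4 :
  ex_series (fun n : nat =>
    (-1) ^ n / 8 ^ n * (4 / (3 * INR n + 1) + 2 / (3 * INR n + 2))) /\
  PI * sqrt 3 =
    9 / 8 * Series (fun n : nat =>
      (-1) ^ n / 8 ^ n * (4 / (3 * INR n + 1) + 2 / (3 * INR n + 2))).
Proof.
  assert (H : is_series (fun n : nat =>
    (-1) ^ n / 8 ^ n * (4 / (3 * INR n + 1) + 2 / (3 * INR n + 2)))
    (prim 1 - prim 0)).
  { apply (is_series_ext (fun n => term n 1)); [| exact is_series_term_1].
    exact term_1. }
  split.
  - exists (prim 1 - prim 0); exact H.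
  - rewrite (is_series_unique _ _ H), prim_diff.
    assert (Hs : 0 < sqrt 3) by (apply sqrt_lt_R0; lra).
    assert (Hss : sqrt 3 * sqrt 3 = 3) by (apply sqrt_sqrt; lra).
    apply (Rmult_eq_reg_r (sqrt 3)); [| lra].
    rewrite Rmult_assoc, Hss.
    field; lra.
Qed.
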